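(* For fixed $\theta$, as $n$ goes to infinity, $$\frac1n\log M_{LP}(n,\theta)\ \ge\ \frac{\log\frac{1}{\sin\theta}}{2}+\frac{\frac{1+\sin\theta}{2\sin\theta}\log\frac{1+\sin\theta}{2\sin\theta}-\frac{1-\sin\theta}{2\sin\theta}\log\frac{1-\sin\theta}{2\sin\theta}}{2}+o(1).$$
   Context: An $n$-dimensional spherical code of angular distance $\theta$ is a subset of the unit sphere $S^{n-1}$ in which the angle between any two distinct points is at least $\theta$. Let $w(t)=(1-t^2)^{\frac{n-3}{2}}$ on $(-1,1)$, and let $P_s=P_s^{\frac{n-3}{2},\frac{n-3}{2}}$ ($s=0,1,2,\dots$) be the Jacobi polynomials of degree $s$, orthogonal on $(-1,1)$ with respect to the weight $w$, in the standard (Szegő) normalization $P_s(1)=\binom{s+\frac{n-3}{2}}{s}$; in particular $P_0\equiv 1$. Delsarte's linear programming upper bound on the cardinality of such codes is $$M_{LP}(n,\theta)=\min\Big\{F(1):\ F=\sum_{s=0}^m a_sP_s,\ a_s\ge 0,\ a_0=1,\ F\le 0\text{ on }[-1,\cos\theta]\Big\},$$ where the degree $m$ of $F$ may be arbitrarily large. Here $o(1)$ denotes a quantity tending to $0$ as $n\to\infty$ with $\theta$ fixed.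
   Formalization: The angle θ is restricted to 0 < θ ≤ π/2 (with 0 log 0 = 0 at π/2); for π/2 < θ < π the claim is false, since F(t) = 1 + t/|cos θ| shows M_LP(n,θ) is bounded in n while the right-hand side is positive. *)

(* Defs.v *)
From mathcomp Require Import all_boot all_order all_algebra.
From mathcomp Require Import all_classical all_reals all_analysis.
Set Implicit Arguments.
Unset Strict Implicit.
Unset Printing Implicit Defensive.
Import Order.TTheory GRing.Theory Num.Theory.
Import numFieldNormedType.Exports.
Local Open Scope classical_set_scope.
Local Open Scope ring_scope.

(* binom(x, k) = x (x - 1) ... (x - k + 1) / k! for real x. *)
Definition gbinom {R : realType} (x : R) (k : nat) : R :=
  (\prod_(i < k) (x - i%:R)) / (k`!)%:R.

Definition jacobi_index (R : realType) (n : nat) : R := (n%:R - 3) / 2.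

Definition jacobi_weight {R : realType} (n : nat) (t : R) : R :=
  (1 - t ^+ 2) `^ jacobi_index R n.

(* P is the sequence of Jacobi polynomials with both parameters (n-3)/2,
   normalized as in Szego.  For n >= 2 the parameter is > -1, all the integrals
   converge and these conditions determine P; for n < 2 the weight is not
   integrable. *)
Definition jacobi_polys {R : realType} (n : nat) (P : nat -> {poly R}) : Prop :=
  [/\ forall s, size (P s) = s.+1,
      forall r s, r <> s ->
        \int[lebesgue_measure]_(t in `]-1, 1[)
          ((P r).[t] * (P s).[t] * jacobi_weight n t) = 0
    & forall s, (P s).[1] = gbinom (s%:R + jacobi_index R n) s].

Definition LP_feasible {R : realType} (P : nat -> {poly R}) (theta : R)
    (F : {poly R}) : Prop :=
  exists (m : nat) (a : nat -> R),
    [/\ F = \sum_(s < m.+1) a s *: P s,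
        forall s, (s <= m)%N -> 0 <= a s,
        a 0%N = 1
      & forall t, -1 <= t <= cos theta -> F.[t] <= 0].

(* The degree of F is unbounded, so the minimum is taken as an infimum; in the
   extended reals, so that no default value is involved. *)
Definition M_LP {R : realType} (P : nat -> {poly R}) (theta : R) : \bar R :=
  ereal_inf [set (F.[1])%:E | F in [set F | LP_feasible P theta F]].

(* At theta = pi/2 the last term is 0 * ln 0 = 0, the usual convention. *)
Definition LP_exponent {R : realType} (theta : R) : R :=
  let u := (1 + sin theta) / (2 * sin theta) in
  let v := (1 - sin theta) / (2 * sin theta) in
  ln (1 / sin theta) / 2 + (u * ln u - v * ln v) / 2.

(* Main.v *)
(* By weak duality, F(1) >= M * Phi(1) for every feasible F as soon as the
   functional Phi is nonpositive on polynomials that are nonpositive on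
   [-1, cos theta] and satisfies P_s(1) + M * Phi(P_s) >= 0 for all s >= 1.
   Take for Phi the integral against the weight over [-1, x], x = cos theta,
   with an extra mass A on a short interval [t0, x].  Let k be such that for
   s <= k the Jacobi polynomial of degree s + 1 in dimension n - 2 has no zero on
   [t0, 1].  By Rodrigues' formula w P_s then decreases on [t0, 1], so the extra
   mass compensates the missing cap [x, 1] and Phi(P_s) >= 0.  For s > k,
   Cauchy-Schwarz on the cap [t0, 1] gives
   |Phi(P_s)| <= (1 + A) |P_s|_2 (sin theta0)^((n-3)/2) with t0 = cos theta0,
   and P_s(1)^2 / |P_s|_2^2 is at least binom(n-3+k, k) up to a constant.  Hence
   M can be taken as the geometric mean of binom(n-3+k, k) and
   (1 / sin theta0)^(n-3), up to subexponential factors; the extremal k is about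
   n (1 - sin theta) / (2 sin theta). *)
Require Import Defs.
From mathcomp Require Import all_boot all_order all_algebra.
From mathcomp Require Import all_classical all_reals all_analysis.
From mathcomp Require Import ring lra zify.
Import Order.TTheory GRing.Theory Num.Theory.
Import numFieldNormedType.Exports.
Local Open Scope classical_set_scope.
Local Open Scope ring_scope.
Set Implicit Arguments.
Unset Strict Implicit.
Unset Printing Implicit Defensive.

(** * Gegenbauer polynomials through Rodrigues' formula *)

Definition rodrigues_op {R : comNzRingType} (m : nat) (q : {poly R}) : {poly R} :=
  m.+2%:R *: ('X * q) - (1 - 'X^2) * q^`().

(* Up to a positive factor, gegen m s is P_s for m = n - 3, defined by Rodrigues'
   formula: (1-t^2)^((m+2)/2) q has derivative
   - (1-t^2)^(m/2) (rodrigues_op m q). *)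
Fixpoint gegen {R : comNzRingType} (m s : nat) : {poly R} :=
  if s is s'.+1 then rodrigues_op m (gegen m.+2 s') else 1.

Section Gegenbauer.
Context {R : realType}.
Local Notation Q := (@gegen R).

Lemma gegenS m s : Q m s.+1 = rodrigues_op m (Q m.+2 s).
Proof. by []. Qed.

Lemma horner_rodrigues_op m (q : {poly R}) t :
  (rodrigues_op m q).[t] = m.+2%:R * t * q.[t] - (1 - t ^+ 2) * q^`().[t].
Proof.
rewrite /rodrigues_op hornerD hornerN hornerZ !hornerM hornerX hornerD hornerN.
by rewrite hornerC hornerXn mulrA.
Qed.

Lemma deriv_rodrigues_op m (q : {poly R}) :
  (rodrigues_op m q)^`() = m.+2%:R *: q + rodrigues_op m.+2 q^`().
Proof.
rewrite /rodrigues_op derivB derivZ !derivM derivX derivB derivXn /= expr1.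
by rewrite derivC -!mul_polyC !polyC_natr; ring.
Qed.

(** By [deriv_rodrigues_op] and induction, both resulting terms are multiples of the same
    polynomial. The coefficient is, up to sign, the eigenvalue of the Gegenbauer differential
    operator. *)
Lemma deriv_gegen m s :
  (Q m s.+1)^`() = (s.+1 * (m + s + 2))%N%:R *: Q m.+2 s.
Proof.
elim: s m => [|s IHs] m.
  rewrite gegenS deriv_rodrigues_op derivC /rodrigues_op derivC.
  by rewrite !mulr0 scaler0 subr0 addr0 mul1n addn0 addn2.
rewrite gegenS deriv_rodrigues_op IHs.
have -> (c : R) (q : {poly R}) :
    rodrigues_op m.+2 (c *: q) = c *: rodrigues_op m.+2 q.
  by rewrite /rodrigues_op derivZ -!mul_polyC; ring.
rewrite -gegenS -scalerDl -natrD; congr (_ *: _); congr _%:R; nia.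
Qed.

Lemma gegen_at1S m s : (Q m s.+1).[1] = m.+2%:R * (Q m.+2 s).[1].
Proof.
by rewrite gegenS horner_rodrigues_op expr1n subrr mul0r subr0 mulr1.
Qed.

Lemma gegen_at1_gt0 m s : 0 < (Q m s).[1].
Proof.
elim: s m => [|s IHs] m; first by rewrite hornerC.
by rewrite gegen_at1S mulr_gt0.
Qed.

(** A positive top derivative serves twice: it fixes the degree, and through [wint_mul_gegen] it
    makes the norm positive. *)
Lemma derivn_gegen m s :
  exists2 c : R, 0 < c & (Q m s)^`(s) = c%:P.
Proof.
elim: s m => [|s IHs] m; first by exists 1.
have [c c0 Ec] := IHs m.+2.
exists ((s.+1 * (m + s + 2))%N%:R * c); last first.
  by rewrite derivSn deriv_gegen derivnZ Ec -mul_polyC -polyCM.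
by rewrite mulr_gt0// ltr0n muln_gt0 addn2.
Qed.

Lemma size_gegen m s : size (Q m s) = s.+1.
Proof.
(* In characteristic zero each derivative lowers the size by at most one. *)
have dsz (p : {poly R}) k : (size p <= size (p^`(k)) + k)%N.
  elim: k => [|k IHk]; first by rewrite addn0.
  rewrite (leq_trans IHk)// addnS -addSn leq_add2r derivnS.
  apply/leq_sizeP => -[//|j] jk; apply/eqP.
  have : (p^`(k))^`()`_j == 0 by rewrite nth_default.
  by rewrite coef_deriv mulrn_eq0.
have size_le : (size (Q m s) <= s.+1)%N.
  have [c c0 Ec] := derivn_gegen m s.
  by apply: leq_trans (dsz _ s) _; rewrite Ec size_polyC gt_eqF.
apply/eqP; rewrite eqn_leq size_le ltnNge; apply/negP => /derivn_poly0 E.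
have [c c0 Ec] := derivn_gegen m s.
by move: E; rewrite Ec => /eqP; rewrite polyC_eq0 gt_eqF.
Qed.

(* The recurrence Q_{m,s+2} = (m+2) t Q_{m+2,s+1} - c (1-t^2) Q_{m+4,s} keeps
   the ratio Q_{m,s+1} / Q_{m+2,s} above half of its leading term as long as
   the discriminant of its characteristic equation is nonnegative. *)
Lemma gegen_ratio m s (t : R) : 0 < t <= 1 ->
  (4 * s * (m + s + 3))%N%:R * (1 - t ^+ 2) <= (m.+2 * m.+4)%N%:R * t ^+ 2 ->
  0 < (Q m.+2 s).[t] /\ m.+2%:R * t * (Q m.+2 s).[t] <= 2 * (Q m s.+1).[t].
Proof.
move=> /andP[t0 t1].
have t2 : 0 <= 1 - t ^+ 2 by rewrite subr_ge0 expr_le1// ltW.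
elim: s m => [|s IHs] m ct.
  rewrite gegenS horner_rodrigues_op derivC horner0 hornerC; split=> //.
  by have := mulr_ge0 (ler0n R m.+2) (ltW t0); lra.
(* The hypothesis survives the shift because s(m+s+5) <= (s+1)(m+s+4) and (m+2)(m+4) <=
   (m+4)(m+6). *)
have ct' : (4 * s * (m.+2 + s + 3))%N%:R * (1 - t ^+ 2)
    <= (m.+4 * m.+2.+4)%N%:R * t ^+ 2.
  apply: le_trans (le_trans ct _).
    by apply: ler_wpM2r => //; rewrite ler_nat; nia.
  by apply: ler_wpM2r; rewrite ?sqr_ge0// ler_nat; nia.
have [Qp Qr] := IHs _ ct'.
have Qp1 : 0 < (Q m.+2 s.+1).[t].
  have Qp0 : 0 < m.+4%:R * t * (Q m.+4 s).[t] by rewrite !mulr_gt0.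
  lra.
split=> //.
rewrite [in leRHS]gegenS horner_rodrigues_op deriv_gegen hornerZ.
set q := (Q m.+4 s).[t] in Qp Qr *; set r := (Q m.+2 s.+1).[t] in Qp1 Qr *.
suff : 2 * ((1 - t ^+ 2) * ((s.+1 * (m.+2 + s + 2))%N%:R * q)) <= m.+2%:R * t * r.
  by lra.
have mt0 : 0 <= m.+2%:R * t by rewrite mulr_ge0 // ltW.
apply: le_trans (_ : m.+2%:R * t * (m.+4%:R * t * q / 2) <= _); last first.
  by apply: ler_wpM2l => //; lra.
have := ler_wpM2r (ltW Qp) ct; rewrite !natrM.
have -> : (m + s.+1 + 3 = m.+2 + s + 2)%N by lia.
lra.
Qed.
End Gegenbauer.

(** * Integrals of continuous functions over compact intervals *)

Section ContinuousIntegral.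
Context {R : realType}.
Local Notation mu := (@lebesgue_measure R).

Lemma continuous_itv_integrable (f : R -> R) (a b : R) :
  continuous f -> mu.-integrable `[a, b] (EFin \o f).
Proof.
move=> cf; apply: continuous_compact_integrable; first exact: segment_compact.
exact: continuous_subspaceT.
Qed.

Lemma continuous_Rintegral_FTC (f F : R -> R) (a b : R) : a <= b ->
  continuous f -> continuous F ->
  {in `]a, b[, forall t : R, is_derive t 1 F (f t)} ->
  \int[mu]_(t in `[a, b]) f t = F b - F a.
Proof.
rewrite le_eqVlt => /predU1P[<- _ _ _|ab cf cF dF].
  by rewrite set_itv1 Rintegral_set1 subrr.
rewrite /Rintegral (@continuous_FTC2 _ f F)//.
- exact: continuous_subspaceT.
- split; [by move=> t /dF dt| |].
  + exact/cvg_at_right_filter/cF.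
  + exact/cvg_at_left_filter/cF.
- by move=> t /dF dt; rewrite derive1E; exact: derive_val.
Qed.

Lemma continuous_Rintegral_split (f : R -> R) (a b c : R) : a <= b <= c ->
  continuous f ->
  \int[mu]_(t in `[a, c]) f t =
  \int[mu]_(t in `[a, b]) f t + \int[mu]_(t in `[b, c]) f t.
Proof.
move=> /andP[ab bc] cf.
have := @Rintegral_itvB R f (BLeft a) (BRight c) b.
rewrite !bnd_simp => /(_ (continuous_itv_integrable _ _ cf) ab bc) /eqP.
rewrite subr_eq addrC => /eqP ->; congr (_ + _).
rewrite Rintegral_itv_obnd_cbnd//.
apply: integrableS (continuous_itv_integrable b c cf) => //.
exact: subset_itv_oc_cc.
Qed.

Lemma le_Rintegral_continuous (f g : R -> R) (a b : R) :
  continuous f -> continuous g -> {in `[a, b], forall t, f t <= g t} ->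
  \int[mu]_(t in `[a, b]) f t <= \int[mu]_(t in `[a, b]) g t.
Proof.
move=> cf cg fg; apply: le_Rintegral => //;
  [exact: (continuous_itv_integrable _ _ cf)|
   exact: (continuous_itv_integrable _ _ cg)].
Qed.

Lemma Rintegral_itv_cst (c a b : R) : a <= b ->
  \int[mu]_(t in `[a, b]) c = c * (b - a).
Proof.
move=> ab; rewrite Rintegral_cst//=; congr (_ * _).
by rewrite lebesgue_measure_itv/= lte_fin; case: ltgtP ab => //= ->; rewrite subrr.
Qed.

End ContinuousIntegral.

(** * Integration against powers of sqrt(1 - t^2) *)

Definition semicircle {R : realType} (t : R) : R := Num.sqrt (1 - t ^+ 2).

(* For m = n - 3 the weight is the w of the Jacobi polynomials. *)
Definition wint {R : realType} (m : nat) (a b : R) (q : {poly R}) : R :=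
  \int[lebesgue_measure]_(t in `[a, b]) (semicircle t ^+ m * q.[t]).

Section WeightedIntegral.
Context {R : realType}.
Local Notation mu := (@lebesgue_measure R).
Local Notation y := (@semicircle R).

Lemma semicircle_ge0 t : 0 <= y t.
Proof. exact: sqrtr_ge0. Qed.

Lemma semicircle_le1 t : y t <= 1.
Proof.
by rewrite -[leRHS]sqrtr1; apply: ler_wsqrtr; rewrite gerBl sqr_ge0.
Qed.

Lemma semicircle_gt0 t : -1 < t < 1 -> 0 < y t.
Proof. by move=> /andP[? ?]; rewrite sqrtr_gt0; nra. Qed.

Lemma sqr_semicircle t : -1 <= t <= 1 -> y t ^+ 2 = 1 - t ^+ 2.
Proof. by move=> /andP[? ?]; rewrite sqr_sqrtr//; nra. Qed.

Lemma semicircle1 : y 1 = 0.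
Proof. by rewrite /semicircle expr1n subrr sqrtr0. Qed.

Lemma semicircleN1 : y (-1) = 0.
Proof. by rewrite /semicircle sqrrN expr1n subrr sqrtr0. Qed.

Lemma semicircle_anti (s t : R) : 0 <= s <= t -> y t <= y s.
Proof.
by move=> /andP[s0 st]; apply: ler_wsqrtr; rewrite lerB// lerXn2r ?nnegrE; lra.
Qed.

(** [Num.sqrt] is 0 on negative arguments, so continuity holds on the whole line and not only on
    [-1, 1]. *)
Lemma continuous_semicircle : continuous y.
Proof.
move=> t; apply: (@continuous_comp _ _ _ (fun t : R => 1 - t ^+ 2)).
  by apply: cvgB; [exact: cvg_cst|exact: exprn_continuous].
exact: sqrt_continuous.
Qed.

Lemma continuous_weighted m (q : {poly R}) :
  continuous (fun t => y t ^+ m * q.[t]).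
Proof.
move=> t; apply: cvgM; last exact: continuous_horner.
apply: (@continuous_comp _ _ _ y (fun u => u ^+ m)).
  exact: continuous_semicircle.
exact: exprn_continuous.
Qed.

Lemma weighted_integrable m (q : {poly R}) (a b : R) :
  mu.-integrable `[a, b] (EFin \o (fun t => y t ^+ m * q.[t])).
Proof. exact/continuous_itv_integrable/continuous_weighted. Qed.

(** The exponent [m.+2] absorbs the 1/y coming from the derivative of the square root and still
    leaves [y t ^+ m]. *)
Lemma is_derive_weighted m (q : {poly R}) (t : R) : -1 < t < 1 ->
  is_derive t 1 (fun t => y t ^+ m.+2 * q.[t])
    (- (y t ^+ m * (rodrigues_op m q).[t])).
Proof.
move=> t1; have y0 := semicircle_gt0 t1.
have t1' : -1 <= t <= 1 by case/andP: t1 => ? ?; rewrite !ltW.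
have d1 : is_derive t 1 (fun t : R => 1 - t ^+ 2) (- (2 * t)).
  by apply: is_derive_eq; rewrite /GRing.scale /=; ring.
have arg0 : 0 < 1 - t ^+ 2 by rewrite -sqrtr_gt0.
have dy : is_derive t 1 y (- t / y t).
  have ds := is_derive1_sqrt arg0.
  have := @is_derive1_comp R Num.sqrt (fun t : R => 1 - t ^+ 2) t _ _ ds d1.
  move=> dc; apply: is_derive_eq dc _.
  by rewrite -/(y t) ; field; rewrite gt_eqF.
have dX0 : is_derive (y t) 1 (fun u : R => u ^+ m.+2) (m.+2%:R * y t ^+ m.+1).
  apply: DeriveDef; first exact: exprn_derivable.
  by rewrite exp_derive /GRing.scale /= mulr1.
have dX := @is_derive1_comp R (fun u : R => u ^+ m.+2) y t _ _ dX0 dy.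
have := @is_deriveM R R (fun t => y t ^+ m.+2) (horner q) t 1 _ _ dX
  (is_derive_poly q t).
move=> dF; apply: is_derive_eq dF _.
rewrite horner_rodrigues_op -(sqr_semicircle t1') /GRing.scale /= !exprS.
by field; rewrite gt_eqF.
Qed.

Lemma wintD m a b (p q : {poly R}) :
  wint m a b (p + q) = wint m a b p + wint m a b q.
Proof.
rewrite /wint -RintegralD//; [|exact: weighted_integrable..].
by apply: eq_Rintegral => t _; rewrite hornerD mulrDr.
Qed.

Lemma wintZ m a b c (p : {poly R}) : wint m a b (c *: p) = c * wint m a b p.
Proof.
rewrite /wint -RintegralZl//; last exact: weighted_integrable.
by apply: eq_Rintegral => t _; rewrite hornerZ mulrCA.
Qed.

Lemma wint0 m a b : wint m a b 0 = 0 :> R.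
Proof. by rewrite -[X in wint _ _ _ X](scale0r 0) wintZ mul0r. Qed.

Lemma wintN m a b (p : {poly R}) : wint m a b (- p) = - wint m a b p.
Proof. by rewrite -scaleN1r wintZ mulN1r. Qed.

Lemma wint_split m a b c (p : {poly R}) : a <= b <= c ->
  wint m a c p = wint m a b p + wint m b c p.
Proof.
by move=> abc; apply: continuous_Rintegral_split => //; exact: continuous_weighted.
Qed.

Lemma le_wint m a b (p q : {poly R}) :
  {in `[a, b], forall t, p.[t] <= q.[t]} -> wint m a b p <= wint m a b q.
Proof.
move=> pq; apply: le_Rintegral_continuous; [exact: continuous_weighted..|].
by move=> t /pq; apply: ler_wpM2l; rewrite exprn_ge0// semicircle_ge0.
Qed.

Lemma wint_ge0 m a b (p : {poly R}) :
  {in `[a, b], forall t, 0 <= p.[t]} -> 0 <= wint m a b p.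
Proof.
by move=> p0; rewrite -(wint0 m a b) le_wint// => t /p0; rewrite horner0.
Qed.

Lemma wint_rodrigues m a b (q : {poly R}) : -1 <= a -> a <= b -> b <= 1 ->
  wint m a b (rodrigues_op m q) = y a ^+ m.+2 * q.[a] - y b ^+ m.+2 * q.[b].
Proof.
move=> a1 ab b1; rewrite /wint.
rewrite (@continuous_Rintegral_FTC _ _ (fun t => - (y t ^+ m.+2 * q.[t])))//.
- by rewrite opprK addrC.
- exact: continuous_weighted.
- by move=> t; apply: cvgN; exact: continuous_weighted.
- move=> t; rewrite in_itv/= => /andP[at1 tb].
  rewrite -[y t ^+ m * _]opprK; apply: is_deriveN.
  by apply: is_derive_weighted; lra.
Qed.

Lemma wint_le_cst m a b (c : R) (q : {poly R}) : a <= b ->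
  {in `[a, b], forall t, y t ^+ m * q.[t] <= c} -> wint m a b q <= c * (b - a).
Proof.
move=> ab qc; rewrite -(Rintegral_itv_cst c ab).
apply: le_Rintegral_continuous => //; first exact: continuous_weighted.
by move=> t; exact: cvg_cst.
Qed.

Lemma wint_ge_cst m a b (c : R) (q : {poly R}) : a <= b ->
  {in `[a, b], forall t, c <= y t ^+ m * q.[t]} -> c * (b - a) <= wint m a b q.
Proof.
move=> ab qc; rewrite -(Rintegral_itv_cst c ab).
apply: le_Rintegral_continuous => //; last exact: continuous_weighted.
by move=> t; exact: cvg_cst.
Qed.

End WeightedIntegral.

(** * Orthogonality, norms, and uniqueness of the orthogonal sequence *)

Section Orthogonality.
Context {R : realType}.
Local Notation Q := (@gegen R).
Local Notation y := (@semicircle R).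

Lemma wint_mul_sqr m (p : {poly R}) :
  wint m (-1) 1 ((1 - 'X^2) * p) = wint m.+2 (-1) 1 p.
Proof.
apply: eq_Rintegral => t; rewrite inE/= in_itv/= => t1.
rewrite hornerM hornerD hornerN hornerC hornerXn -(sqr_semicircle t1) !exprS.
ring.
Qed.

(** Integration by parts: [y] vanishes at both endpoints, so no boundary term remains. *)
Lemma wint_mul_rodrigues m (p q : {poly R}) :
  wint m (-1) 1 (p * rodrigues_op m q) = wint m.+2 (-1) 1 (p^`() * q).
Proof.
have -> : p * rodrigues_op m q =
    rodrigues_op m (p * q) + (1 - 'X^2) * (p^`() * q).
  by rewrite /rodrigues_op derivM -!mul_polyC; ring.
rewrite wintD wint_mul_sqr wint_rodrigues//.
by rewrite semicircle1 semicircleN1 !exprS !mul0r subr0 add0r.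
Qed.

(** Each of the [s] layers of Rodrigues' formula moves one derivative onto [p] and raises the
    exponent of the weight by 2. Orthogonality to lower degrees and positivity of the norm both
    follow. *)
Lemma wint_mul_gegen m s (p : {poly R}) :
  wint m (-1) 1 (p * Q m s) = wint (m + s.*2) (-1) 1 p^`(s).
Proof.
elim: s m p => [|s IHs] m p; first by rewrite mulr1 addn0.
by rewrite gegenS wint_mul_rodrigues IHs derivSn; congr (wint _ _ _ _); lia.
Qed.

Lemma gegen_orthogonal m s (p : {poly R}) : (size p <= s)%N ->
  wint m (-1) 1 (p * Q m s) = 0.
Proof. by move=> sp; rewrite wint_mul_gegen derivn_poly0// wint0. Qed.

(** Integrate ['X] against [rodrigues_op m 1] by parts and write t^2 = 1 - (1 - t^2). *)
Lemma wint1_recl m :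
  m.+3%:R * wint m.+2 (-1) 1 (1 : {poly R}) =
  m.+2%:R * wint m (-1) 1 (1 : {poly R}).
Proof.
have := wint_mul_rodrigues m 'X (1 : {poly R}).
rewrite derivX mulr1.
have -> : 'X * rodrigues_op m 1 = m.+2%:R *: (1 : {poly R}) - m.+2%:R *: ((1 - 'X^2) * 1).
  by rewrite /rodrigues_op derivC -!mul_polyC; ring.
rewrite wintD wintN !wintZ wint_mul_sqr => E.
rewrite -[in X in X * _]natr1 mulrDl mul1r; lra.
Qed.

(** On [-1, 0] one has 1 + t <= sqrt(1 - t^2), and (1 + t)^m integrates to 1/(m+1). *)
Lemma wint1_left_ge m : m.+1%:R^-1 <= wint m (-1) 0 (1 : {poly R}).
Proof.
pose F : {poly R} := m.+1%:R^-1 *: (1 + 'X) ^+ m.+1.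
have F0 : F.[0] = m.+1%:R^-1.
  by rewrite /F hornerZ horner_exp hornerD hornerC hornerX addr0 expr1n mulr1.
have F1 : F.[-1] = 0.
  by rewrite /F hornerZ horner_exp hornerD hornerC hornerX subrr exprS mul0r mulr0.
have <- : \int[lebesgue_measure]_(t in `[(-1 : R), 0]) (F^`()).[t] = m.+1%:R^-1.
  rewrite (@continuous_Rintegral_FTC R (horner F^`()) (horner F)).
  - by rewrite F0 F1 subr0.
  - by lra.
  - exact: continuous_horner.
  - exact: continuous_horner.
  - by move=> t _; exact: is_derive_poly.
apply: le_Rintegral_continuous; [exact: continuous_horner|exact: continuous_weighted|].
move=> t; rewrite in_itv/= => /andP[tm1 t0].
rewrite hornerC mulr1 /F derivZ deriv_exp derivD derivC derivX add0r mul1r.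
rewrite hornerZ hornerMn horner_exp hornerD hornerC hornerX.
rewrite -[_ ^+ _ *+ _]mulr_natl mulKf//=.
rewrite lerXn2r ?nnegrE ?semicircle_ge0//; first by lra.
rewrite -[leLHS]ger0_norm -?sqrtr_sqr; last by lra.
by apply: ler_wsqrtr; nra.
Qed.

Lemma wint1_gt0 m : 0 < wint m (-1) 1 (1 : {poly R}).
Proof.
rewrite (@wint_split _ _ (-1) 0 1); last by lra.
apply: ltr_wpDr; first by apply: wint_ge0 => t _; rewrite hornerC.
by apply: lt_le_trans (wint1_left_ge m); rewrite invr_gt0.
Qed.

Lemma wint_gegen_sqrS m s : wint m (-1) 1 (Q m s.+1 * Q m s.+1) =
  (s.+1 * (m + s + 2))%N%:R * wint m.+2 (-1) 1 (Q m.+2 s * Q m.+2 s).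
Proof.
by rewrite [in X in _ * X]gegenS wint_mul_rodrigues deriv_gegen -scalerAl wintZ.
Qed.

(** Along (m, s+1) -> (m+2, s) the norm, the value at 1 and the total mass obey exact recursions, so
    the induction reduces to an inequality between binomials. *)
Lemma gegen_norm_le m s :
  'C(m + s, s)%:R * wint m (-1) 1 (Q m s * Q m s) <=
  (Q m s).[1] ^+ 2 * wint m (-1) 1 1.
Proof.
elim: s m => [|s IHs] m.
  by rewrite bin0 !mul1r hornerC expr1n mul1r.
rewrite wint_gegen_sqrS gegen_at1S.
have B0 : wint m (-1) 1 1 = m.+2%:R^-1 * (m.+3%:R * wint m.+2 (-1) 1 (1 : {poly R})).
  by rewrite wint1_recl mulKf.
rewrite B0.
have -> : (m.+2%:R * (Q m.+2 s).[1]) ^+ 2 *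
   (m.+2%:R^-1 * (m.+3%:R * wint m.+2 (-1) 1 1)) =
   (m.+2 * m.+3)%N%:R * ((Q m.+2 s).[1] ^+ 2 * wint m.+2 (-1) 1 1).
  by rewrite natrM; field.
apply: le_trans (ler_wpM2l (ler0n _ _) (IHs m.+2)).
rewrite mulrA mulrA -!natrM ler_wpM2r//.
  by apply: wint_ge0 => t _; rewrite hornerM -expr2 sqr_ge0.
rewrite ler_nat.
(* The three identities turn the left side into (m+1)(m+2) C(m+2+s, s), against (m+2)(m+3) C(m+2+s,
   s) on the right. *)
have H1 : (s.+1 * 'C(m + s.+1, s.+1) = (m + s).+1 * 'C(m + s, s))%N.
  by rewrite -mul_bin_diag addnS.
have H2 : ((m + s).+1 * 'C(m + s, s) = m.+1 * 'C((m + s).+1, s))%N.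
  by have /= -> := mul_bin_down (m + s).+1 s; congr (_ * _)%N; lia.
have H3 : ((m + s).+2 * 'C((m + s).+1, s) = m.+2 * 'C(m.+2 + s, s))%N.
  by have /= -> := mul_bin_down (m + s).+2 s; congr (_ * _)%N; lia.
by nia.
Qed.

Lemma wint1_le2 m : wint m (-1) 1 (1 : {poly R}) <= 2.
Proof.
have -> : 2 = 1 * (1 - -1) :> R by rewrite opprK mul1r.
apply: wint_le_cst; first lra.
move=> t _; rewrite hornerC mulr1.
by rewrite exprn_ile1 ?semicircle_ge0 ?semicircle_le1.
Qed.

Lemma gegen_norm_gt0 m s : 0 < wint m (-1) 1 (Q m s * Q m s).
Proof.
have [c c0 Ec] := derivn_gegen (R := R) m s.
by rewrite wint_mul_gegen Ec -[c%:P]mulr1 mul_polyC wintZ mulr_gt0// wint1_gt0.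
Qed.

Lemma size_sub_lead_coef (p q : {poly R}) k : size p = k.+1 -> size q = k.+1 ->
  (size (p - (lead_coef p / lead_coef q) *: q)%R <= k)%N.
Proof.
move=> sp sq; have q0 : lead_coef q != 0.
  by rewrite lead_coef_eq0 -size_poly_eq0 sq.
apply/leq_sizeP => j; rewrite leq_eqVlt => /predU1P[<-|kj].
  by rewrite coefB coefZ !lead_coefE sp sq /= in q0 *; rewrite divfK// subrr.
by rewrite coefB coefZ !nth_default ?mulr0 ?subr0// ?sp ?sq.
Qed.

(** Subtracting a multiple of [p k] kills the leading term of [q], so induction on the size
    applies. *)
Lemma graded_orthogonal m (p : nat -> {poly R}) (s : nat) (q : {poly R}) :
  (forall k, size (p k) = k.+1) ->
  (forall r, (r < s)%N -> wint m (-1) 1 (p r * p s) = 0) ->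
  (size q <= s)%N -> wint m (-1) 1 (q * p s) = 0.
Proof.
move=> sp orth; move: {-1}(size q) (leqnn (size q)) => k.
elim: k q => [|k IHk] q.
  by rewrite leqn0 size_poly_eq0 => /eqP -> _; rewrite mul0r wint0.
rewrite leq_eqVlt => /predU1P[sq ks|]; last by move=> qk ks; apply: IHk => //; lia.
have sz := size_sub_lead_coef sq (sp k).
set c := (_ / _) in sz.
have := IHk _ sz (ltnW ks).
rewrite mulrBl wintD wintN -scalerAl wintZ orth//.
by rewrite mulr0 oppr0 addr0.
Qed.

(** Uniqueness of orthogonal polynomials up to scaling; the sign of the factor is read off at 1. *)
Lemma orthogonal_gegen m (p : nat -> {poly R}) :
  (forall s, size (p s) = s.+1) ->
  (forall r s, r <> s -> wint m (-1) 1 (p r * p s) = 0) ->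
  (forall s, 0 < (p s).[1]) ->
  forall s, exists2 c, 0 < c & p s = c *: Q m s.
Proof.
move=> sp orth p1 s.
pose c := lead_coef (p s) / lead_coef (Q m s).
have sr : (size (p s - c *: Q m s)%R <= s)%N.
  exact: size_sub_lead_coef (sp s) (size_gegen m s).
have rorth (q : {poly R}) : (size q <= s)%N ->
      wint m (-1) 1 ((p s - c *: Q m s) * q) = 0.
  move=> sq; rewrite mulrC mulrBr wintD wintN.
  rewrite (graded_orthogonal sp _ sq); last by move=> r rs; apply: orth; lia.
  by rewrite -scalerAr wintZ gegen_orthogonal// mulr0 subr0.
have E : p s - c *: Q m s = 0.
  (* If r had degree k < s, write r = d Q_k + lower terms; pairing with Q_k, to which r is
     orthogonal, forces d = 0. *)
  set r := _ - _ in sr rorth *.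
  apply/eqP; rewrite -size_poly_eq0; case Er : (size r) => [//|k].
  have sd := size_sub_lead_coef Er (size_gegen m k).
  set d := (_ / _) in sd.
  have := gegen_orthogonal m sd.
  rewrite mulrBl wintD wintN -scalerAl wintZ rorth; last by rewrite size_gegen -Er.
  move/eqP; rewrite sub0r oppr_eq0 mulf_eq0 (gt_eqF (gegen_norm_gt0 _ _)) orbF.
  rewrite /d mulf_eq0 invr_eq0 !lead_coef_eq0 -!size_poly_eq0 size_gegen Er.
  by [].
have Ep : p s = c *: Q m s by apply/eqP; rewrite -subr_eq0 E.
exists c => //.
by move: (p1 s); rewrite Ep hornerZ pmulr_lgt0// gegen_at1_gt0.
Qed.
End Orthogonality.

(** * The dual functional and weak duality *)

Section DualFunctional.
Context {R : realType}.
Local Notation Q := (@gegen R).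
Local Notation y := (@semicircle R).

(* y^(m+2) Q_{m+2,s} has derivative - y^m Q_{m,s+1}. *)
Lemma weighted_gegen_anti m s (t0 a b : R) :
  0 < t0 -> t0 <= a -> a <= b -> b <= 1 ->
  (4 * s * (m + s + 3))%N%:R * (1 - t0 ^+ 2) <= (m.+2 * m.+4)%N%:R * t0 ^+ 2 ->
  y b ^+ m.+2 * (Q m.+2 s).[b] <= y a ^+ m.+2 * (Q m.+2 s).[a].
Proof.
move=> t00 t0a ab b1 ct.
rewrite -subr_ge0 -wint_rodrigues//; last by lra.
apply: wint_ge0 => t; rewrite in_itv/= => /andP[at_ tb].
have t0t : t0 ^+ 2 <= t ^+ 2 by rewrite lerXn2r ?nnegrE; lra.
have ctt : (4 * s * (m + s + 3))%N%:R * (1 - t ^+ 2)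
    <= (m.+2 * m.+4)%N%:R * t ^+ 2.
  apply: le_trans (le_trans ct _).
    by rewrite ler_wpM2l// lerB.
  by rewrite ler_wpM2l.
have t1 : 0 < t <= 1 by lra.
have [Q0 Q1] := gegen_ratio t1 ctt.
have : 0 < m.+2%:R * t * (Q m.+2 s).[t] by rewrite !mulr_gt0//; lra.
rewrite -gegenS; lra.
Qed.

(** The integrand decreases on [t0, 1], so its value [g] at [x] separates its averages over the two
    intervals. *)
Lemma gegen_cap_le m s (t0 x : R) : 0 < t0 -> t0 <= x -> x <= 1 ->
  (4 * s * (m + s + 3))%N%:R * (1 - t0 ^+ 2) <= (m.+2 * m.+4)%N%:R * t0 ^+ 2 ->
  (x - t0) * wint m.+2 x 1 (Q m.+2 s) <= (1 - x) * wint m.+2 t0 x (Q m.+2 s).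
Proof.
move=> t00 t0x x1 ct; set g := y x ^+ m.+2 * (Q m.+2 s).[x].
have h1 : wint m.+2 x 1 (Q m.+2 s) <= g * (1 - x).
  apply: wint_le_cst => // t; rewrite in_itv/= => /andP[xt t1].
  exact: (weighted_gegen_anti t00 t0x xt t1 ct).
have h2 : g * (x - t0) <= wint m.+2 t0 x (Q m.+2 s).
  apply: wint_ge_cst => // t; rewrite in_itv/= => /andP[xt t1].
  exact: (weighted_gegen_anti t00 xt t1 x1 ct).
have x1' : 0 <= 1 - x by rewrite subr_ge0.
have xt0 : 0 <= x - t0 by rewrite subr_ge0.
have := ler_wpM2l xt0 h1; have := ler_wpM2l x1' h2; lra.
Qed.

(* A multiple of this functional, plus evaluation at 1, is the dual solution. *)
Definition dual_functional m (t0 x A : R) (p : {poly R}) : R :=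
  wint m (-1) x p + A * wint m t0 x p.

(** For s > 0 the full integral vanishes, so the integral over [-1, x] is minus the one over the cap
    [x, 1]. The extra mass is the ratio of lengths with which [gegen_cap_le] compensates it. *)
Lemma dual_functional_gegen_ge0 m s (t0 x : R) : (0 < s)%N ->
  0 < t0 -> t0 < x -> x <= 1 ->
  (4 * s * (m + s + 3))%N%:R * (1 - t0 ^+ 2) <= (m.+2 * m.+4)%N%:R * t0 ^+ 2 ->
  0 <= dual_functional m.+2 t0 x ((1 - x) / (x - t0)) (Q m.+2 s).
Proof.
move=> s0 t00 t0x x1 ct.
have xt0 : 0 < x - t0 by rewrite subr_gt0.
have Q0 : wint m.+2 (-1) 1 (Q m.+2 s) = 0.
  by rewrite -[Q _ _]mul1r gegen_orthogonal// size_poly1.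
have E : wint m.+2 x 1 (Q m.+2 s) = - wint m.+2 (-1) x (Q m.+2 s).
  have := @wint_split R m.+2 (-1) x 1 (Q m.+2 s); rewrite Q0.
  have x11 : -1 <= x <= 1 by lra.
  move=> /(_ x11); lra.
have := gegen_cap_le t00 (ltW t0x) x1 ct.
rewrite E -ler_pdivlMl// mulrA => h.
by rewrite /dual_functional [_ / _]mulrC; lra.
Qed.

(* Pointwise |Q| <= (c Q^2 + 1/c) / 2. *)
Lemma dual_functional_gegen_ge m s (t0 x A c : R) : (0 < s)%N ->
  0 <= t0 -> t0 <= x -> x <= 1 -> 0 <= A -> 0 < c ->
  - ((1 + A) / 2 * (c * wint m (-1) 1 (Q m s * Q m s) + y t0 ^+ m / c))
    <= dual_functional m t0 x A (Q m s).
Proof.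
move=> s0 t00 t0x x1 A0 c0.
pose g : {poly R} := (c / 2) *: (Q m s * Q m s) + (2 * c)^-1 *: 1.
have gE t : g.[t] = (c * (Q m s).[t] ^+ 2 + c^-1) / 2.
  by rewrite hornerD !hornerZ hornerM hornerC; field; rewrite gt_eqF.
have g0 t : 0 <= g.[t].
  by rewrite gE divr_ge0// addr_ge0// ?invr_ge0 ?(ltW c0)// mulr_ge0 ?sqr_ge0 ?(ltW c0).
have sq (e : R) : e = 1 \/ e = -1 -> forall t, (e *: Q m s).[t] <= g.[t].
  move=> he t; rewrite gE hornerZ -subr_ge0.
  have -> : (c * (Q m s).[t] ^+ 2 + c^-1) / 2 - e * (Q m s).[t] =
     (c * (Q m s).[t] - e) ^+ 2 / (2 * c) + (1 - e ^+ 2) / (2 * c).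
    by field; rewrite gt_eqF.
  apply: addr_ge0; first by rewrite divr_ge0 ?sqr_ge0// mulr_ge0// ltW.
  by case: he => ->; rewrite ?sqrrN expr1n subrr mul0r.
have G : wint m t0 1 g <= (c * wint m (-1) 1 (Q m s * Q m s) + y t0 ^+ m / c) / 2.
  rewrite wintD !wintZ.
  have h1 : wint m t0 1 (Q m s * Q m s) <= wint m (-1) 1 (Q m s * Q m s).
    rewrite (@wint_split _ _ (-1) t0 1); last by lra.
    by rewrite lerDr wint_ge0// => t _; rewrite hornerM -expr2 sqr_ge0.
  have h2 : wint m t0 1 1 <= y t0 ^+ m * (1 - t0).
    apply: wint_le_cst; first lra.
    move=> t; rewrite in_itv/= => /andP[t0t t1].
    by rewrite hornerC mulr1 lerXn2r ?nnegrE ?semicircle_ge0// semicircle_anti// t00.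
  have h3 : y t0 ^+ m * (1 - t0) <= y t0 ^+ m.
    by rewrite ler_piMr ?exprn_ge0 ?semicircle_ge0//; lra.
  have -> : (c * wint m (-1) 1 (Q m s * Q m s) + y t0 ^+ m / c) / 2 =
    c / 2 * wint m (-1) 1 (Q m s * Q m s) + (2 * c)^-1 * y t0 ^+ m.
    by field; rewrite gt_eqF.
  apply: lerD; rewrite ler_wpM2l//; [lra| |exact: le_trans h2 h3].
  by rewrite invr_ge0 mulr_ge0// ltW.
(* The vanishing full integral turns the functional into A times the integral over [t0, x] minus the
   one over [x, 1]; both are controlled by the integral of [g] over [t0, 1]. *)
have Q0 : wint m (-1) 1 (Q m s) = 0.
  by rewrite -[Q _ _]mul1r gegen_orthogonal// size_poly1.
have split1 : wint m (-1) 1 (Q m s) = wint m (-1) x (Q m s) + wint m x 1 (Q m s).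
  by apply: wint_split; lra.
have split2 : wint m t0 1 g = wint m t0 x g + wint m x 1 g.
  by apply: wint_split; lra.
have g1 : 0 <= wint m t0 x g by apply: wint_ge0 => t _.
have g2 : 0 <= wint m x 1 g by apply: wint_ge0 => t _.
have u1 : wint m x 1 (Q m s) <= wint m x 1 g.
  by rewrite -[Q m s]scale1r; apply: le_wint => t _; apply: sq; left.
have u2 : - wint m t0 x (Q m s) <= wint m t0 x g.
  by rewrite -wintN -scaleN1r; apply: le_wint => t _; apply: sq; right.
have u3 : A * - wint m t0 x (Q m s) <= A * wint m t0 1 g.
  by rewrite ler_wpM2l//; lra.
have u4 : (1 + A) * wint m t0 1 g <= (1 + A) *
    ((c * wint m (-1) 1 (Q m s * Q m s) + y t0 ^+ m / c) / 2).
  by rewrite ler_wpM2l//; lra.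
rewrite /dual_functional; lra.
Qed.

Lemma dual_functionalD m t0 x A (p q : {poly R}) :
  dual_functional m t0 x A (p + q) =
  dual_functional m t0 x A p + dual_functional m t0 x A q.
Proof. by rewrite /dual_functional !wintD; ring. Qed.

Lemma dual_functionalZ m t0 x A c (p : {poly R}) :
  dual_functional m t0 x A (c *: p) = c * dual_functional m t0 x A p.
Proof. by rewrite /dual_functional !wintZ; ring. Qed.

Lemma dual_functional_sum m t0 x A n (f : nat -> {poly R}) :
  dual_functional m t0 x A (\sum_(i < n) f i) =
  \sum_(i < n) dual_functional m t0 x A (f i).
Proof.
elim: n => [|n IHn]; last by rewrite !big_ord_recr /= dual_functionalD IHn.
by rewrite !big_ord0 /dual_functional !wint0 mulr0 addr0.
Qed.

(** Weak duality: F(1) + M Phi(F) is the sum of the a_s (p_s(1) + M Phi(p_s)). Here Phi(F) <= 0, the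
    terms with s > 0 are nonnegative, and the term s = 0 is at least M Phi(1) >= M/(m+3). *)
Lemma LP_feasible_at1_ge m k (t0 x M : R) (p : nat -> {poly R}) (n : nat)
    (a : nat -> R) :
  let F : {poly R} := \sum_(s < n.+1) a s *: p s in
  let A : R := (1 - x) / (x - t0) in
  p 0%N = 1 -> (forall s, exists2 c : R, 0 < c & p s = c *: Q m.+2 s) ->
  0 < t0 -> t0 < x -> x <= 1 ->
  (4 * k * (m + k + 3))%N%:R * (1 - t0 ^+ 2) <= (m.+2 * m.+4)%N%:R * t0 ^+ 2 ->
  0 < M -> 2 * (M * (1 + A)) ^+ 2 * y t0 ^+ m.+2 <= 'C(m.+2 + k, k)%:R ->
  (forall s, (s <= n)%N -> 0 <= a s) -> a 0%N = 1 ->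
  (forall t : R, -1 <= t <= x -> F.[t] <= 0) ->
  M / m.+3%:R <= F.[1].
Proof.
move=> F A p0 pQ t00 t0x x1 ck M0 MC a_ge0 a0 Fle0.
have A0 : 0 <= A by rewrite /A divr_ge0//; lra.
pose Phi (q : {poly R}) := dual_functional m.+2 t0 x A q.
have PhiF : Phi F <= 0.
  have le0 (b : R) : -1 <= b -> wint m.+2 b x F <= 0.
    move=> b1; rewrite -(wint0 m.+2 b x); apply: le_wint => t.
    by rewrite in_itv/= horner0 => /andP[bt tx]; apply: Fle0; lra.
  rewrite /Phi /dual_functional; have := le0 (-1) (lexx _).
  have t01 : -1 <= t0 by lra.
  have := ler_wpM2l A0 (le0 _ t01); lra.
have pos s : (0 < s)%N -> 0 <= (Q m.+2 s).[1] + M * Phi (Q m.+2 s).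
  move=> s0; set E := (Q m.+2 s).[1].
  have E0 : 0 < E by exact: gegen_at1_gt0.
  (* Low degrees use monotonicity on the cap, high degrees the norm bound. *)
  have [sk|ks] := leqP s k.
    apply: addr_ge0; first exact: ltW.
    apply: mulr_ge0; first exact: ltW.
    apply: dual_functional_gegen_ge0 => //.
    apply: le_trans ck; apply: ler_wpM2r; last by rewrite ler_nat; nia.
    by rewrite subr_ge0 expr_le1//; lra.
  set N := wint m.+2 (-1) 1 (Q m.+2 s * Q m.+2 s).
  have N0 : 0 < N by exact: gegen_norm_gt0.
  have A1 : 0 < 1 + A by lra.
  (* This [c] makes the first error term exactly E/2; [MC] and the norm bound [NE] then keep the
     second at most E/2. *)
  pose c := E / (M * (1 + A) * N).
  have c0 : 0 < c by rewrite divr_gt0// !mulr_gt0.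
  have := @dual_functional_gegen_ge m.+2 s t0 x A c s0 (ltW t00) (ltW t0x) x1 A0 c0.
  rewrite -/N -/(Phi _) => PhiQ.
  have NE : 'C(m.+2 + k, k)%:R * N <= 2 * E ^+ 2.
    have CC : 'C(m.+2 + k, k)%:R * N <= 'C(m.+2 + s, s)%:R * N.
      rewrite ler_wpM2r ?(ltW N0)// ler_nat.
      rewrite -[X in (X <= _)%N]bin_sub ?leq_addl// addnK.
      rewrite -[X in (_ <= X)%N]bin_sub ?leq_addl// addnK.
      by apply: leq_bin2l; lia.
    apply: le_trans CC (le_trans (gegen_norm_le _ _) _).
    by rewrite mulrC ler_wpM2r ?sqr_ge0// wint1_le2.
  have main : M * ((1 + A) / 2 * (c * N + y t0 ^+ m.+2 / c)) <= E.
    have -> : M * ((1 + A) / 2 * (c * N + y t0 ^+ m.+2 / c)) =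
      E / 2 + ((M * (1 + A)) ^+ 2 * y t0 ^+ m.+2) * N / (2 * E).
      by rewrite /c; field; rewrite !gt_eqF.
    suff : ((M * (1 + A)) ^+ 2 * y t0 ^+ m.+2) * N / (2 * E) <= E / 2 by lra.
    rewrite ler_pdivrMr ?mulr_gt0//.
    by have := ler_wpM2r (ltW N0) MC; lra.
  have := ler_wpM2l (ltW M0) PhiQ; lra.
have Phi1 : m.+3%:R^-1 <= Phi 1.
  rewrite /Phi /dual_functional (@wint_split _ _ (-1) 0 x); last by lra.
  have h1 : 0 <= wint m.+2 0 x (1 : {poly R}).
    by apply: wint_ge0 => t _; rewrite hornerC.
  have h2 : 0 <= A * wint m.+2 t0 x (1 : {poly R}).
    by rewrite mulr_ge0// wint_ge0// => t _; rewrite hornerC.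
  apply: le_trans (wint1_left_ge m.+2) _.
  by rewrite -addrA lerDl addr_ge0.
have : F.[1] + M * Phi F = \sum_(s < n.+1) a s * ((p s).[1] + M * Phi (p s)).
  rewrite /Phi /F (dual_functional_sum _ _ _ _ _ (fun s => a s *: p s)) horner_sum.
  rewrite mulr_sumr -big_split /=.
  by apply: eq_bigr => s _; rewrite hornerZ dual_functionalZ; ring.
have MPhiF : M * Phi F <= 0 by rewrite pmulr_rle0.
rewrite big_ord_recl /= a0 p0 hornerC mul1r => E.
have sum0 : 0 <= \sum_(i < n) a (bump 0 i) *
    ((p (bump 0 i)).[1] + M * Phi (p (bump 0 i))).
  apply: sumr_ge0 => i _; apply: mulr_ge0; first exact/a_ge0/ltn_ord.
  have [c c0 ->] := pQ (bump 0 i).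
  rewrite hornerZ /Phi dual_functionalZ mulrCA -mulrDr mulr_ge0 ?(ltW c0)//.
  exact: pos.
apply: le_trans (ler_wpM2l (ltW M0) Phi1) _.
move: E sum0 MPhiF; move: (F.[1]) (M * Phi F) (M * Phi 1) (\sum_(i < n) _).
by move=> f1 f2 f3 f4; lra.
Qed.
End DualFunctional.

(** * Identification of the Jacobi polynomials, and the bound in a fixed dimension *)

Section JacobiGegenbauer.
Context {R : realType}.
Local Notation Q := (@gegen R).
Local Notation y := (@semicircle R).

Lemma jacobi_indexE m : jacobi_index R m.+3 = m%:R / 2.
Proof. by rewrite /jacobi_index -[m.+3]addn3 natrD addrK. Qed.

Lemma jacobi_weightE m (t : R) : -1 < t < 1 ->
  jacobi_weight m.+3 t = y t ^+ m.
Proof.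
move=> t1; rewrite /jacobi_weight jacobi_indexE mulrC powRrM.
have t0 : 0 <= 1 - t ^+ 2 by case/andP: t1 => ? ?; nra.
by rewrite powR12_sqrt// powR_mulrn ?sqrtr_ge0.
Qed.

Lemma wint_jacobi m (p q : {poly R}) :
  \int[lebesgue_measure]_(t in `]-1, 1[) (p.[t] * q.[t] * jacobi_weight m.+3 t)
  = wint m (-1) 1 (p * q).
Proof.
pose f (t : R) := y t ^+ m * (p * q).[t].
transitivity (\int[lebesgue_measure]_(t in `]-1, 1[) f t).
  apply: eq_Rintegral => t; rewrite inE/= in_itv/= => t1.
  by rewrite jacobi_weightE// /f hornerM mulrC.
rewrite Rintegral_itv_bndo_bndc; last first.
  apply: integrableS (weighted_integrable m (p * q) (-1) 1) => //.
  exact: subset_itvW.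
rewrite Rintegral_itv_obnd_cbnd//.
apply: integrableS (weighted_integrable m (p * q) (-1) 1) => //.
exact: subset_itv_oc_cc.
Qed.

Lemma gbinom_gt0 (x : R) s : s%:R - 1 < x -> 0 < gbinom x s.
Proof.
move=> sx; rewrite /gbinom divr_gt0 ?ltr0n ?fact_gt0//.
apply: prodr_gt0 => i _; rewrite subr_gt0.
apply: le_lt_trans sx; rewrite lerBrDr natr1 ler_nat; exact: ltn_ord.
Qed.

(** Uniqueness applies because the prescribed values at 1 are positive: s + m/2 > s - 1. In degree 0
    the normalization is an empty product. *)
Lemma jacobi_polys_gegen m (P : nat -> {poly R}) : jacobi_polys m.+3 P ->
  P 0%N = 1 /\ forall s, exists2 c : R, 0 < c & P s = c *: Q m s.
Proof.
move=> [sP orth P1]; split.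
  have := sP 0%N; move=> /eqP/size_poly1P[c c0 Ec].
  have := P1 0%N; rewrite Ec hornerC /gbinom big_ord0 fact0 divr1 => ->.
  by [].
apply: orthogonal_gegen => // [r s rs|s].
  by rewrite -wint_jacobi orth.
rewrite P1 gbinom_gt0// jacobi_indexE.
by have := ler0n R m; lra.
Qed.

(** Here m + 2 is n - 3. The choice of [t0] gives [y t0 = (1 + 2 * rho)^-1], and M saturates the
    binomial constraint of [LP_feasible_at1_ge]. *)
Lemma M_LP_ge m k (theta rho : R) (P : nat -> {poly R}) :
  jacobi_polys m.+2.+3 P ->
  let x := cos theta in
  let t0 := Num.sqrt (1 - (1 + 2 * rho) ^- 2) in
  let A := (1 - x) / (x - t0) in
  0 < rho -> t0 < x -> k%:R <= rho * m.+2%:R ->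
  ((Num.sqrt ('C(m.+2 + k, k)%:R * (1 + 2 * rho) ^+ m.+2 / 2) /
    ((1 + A) * m.+3%:R))%:E <= M_LP P theta)%E.
Proof.
move=> /jacobi_polys_gegen[P0 Pc] x t0 A rho0 t0x kr.
have d1 : 1 < 1 + 2 * rho by lra.
have d0 : 0 < 1 + 2 * rho by lra.
have e1 : (1 + 2 * rho) ^- 2 < 1 by rewrite invf_lt1 ?exprn_gt0// expr_gt1// ltW.
have t00 : 0 < t0 by rewrite sqrtr_gt0 subr_gt0.
have t02 : t0 ^+ 2 = 1 - (1 + 2 * rho) ^- 2 by rewrite sqr_sqrtr// subr_ge0 ltW.
have yt0 : y t0 = (1 + 2 * rho)^-1.
  by rewrite /semicircle t02 subKr -exprVn sqrtr_sqr ger0_norm// invr_ge0 ltW.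
have x1 : x <= 1 by exact: cos_le1.
have A0 : 0 <= A by rewrite /A divr_ge0//; lra.
have A1 : 0 < 1 + A by rewrite ltr_wpDr.
have C0 : 0 < 'C(m.+2 + k, k)%:R :> R by rewrite ltr0n bin_gt0 leq_addl.
set C := 'C(_, _)%:R in C0 *.
set M := Num.sqrt (C * (1 + 2 * rho) ^+ m.+2 / 2) / (1 + A).
have M0 : 0 < M.
  by rewrite divr_gt0// sqrtr_gt0 divr_gt0// mulr_gt0// exprn_gt0.
apply: le_ereal_inf_tmp => _ /= [F [n [a [EF a_ge0 a0 Fle0]]] <-].
rewrite lee_fin invfM mulrA -/M EF.
apply: (@LP_feasible_at1_ge R m k t0 x M P n a) => //.
(* With N = m + 2, multiplying by (1 + 2 rho)^2 reduces this to k(N+k+1) <= N(N+2) rho(1+rho); at k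
   = rho N the sides differ by N rho (1 + 2 rho). *)
- rewrite t02 subKr -exprVn -(ler_pM2r (exprn_gt0 2 d0)).
  have -> : (4 * k * (m + k + 3))%N%:R * (1 + 2 * rho)^-1 ^+ 2 * (1 + 2 * rho) ^+ 2
     = 4 * (k%:R * (m.+2%:R + k%:R + 1)) :> R.
    by rewrite !natrM !natrD -[m.+2]addn2 natrD; field; rewrite gt_eqF.
  have -> : (m.+2 * m.+4)%N%:R * (1 - (1 + 2 * rho)^-1 ^+ 2) * (1 + 2 * rho) ^+ 2
     = 4 * (m.+2%:R * (m.+2%:R + 2) * (rho * (1 + rho))) :> R.
    by rewrite !natrM -[m.+4]addn2 natrD; field; rewrite gt_eqF.
  rewrite ler_wpM2l//.
  have k0 : 0 <= k%:R :> R by [].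
  have m0 : 0 <= m.+2%:R :> R by [].
  move: k0 m0 kr; set K : R := k%:R; set N : R := m.+2%:R => k0 m0 kr.
  apply: (@le_trans _ _ (rho * N * (N + rho * N + 1))).
    by apply: ler_pM => //; lra.
  rewrite -subr_ge0 [leRHS](_ : _ = N * rho * (1 + 2 * rho)); last by ring.
  by rewrite !mulr_ge0// ltW.
- rewrite yt0 /M divfK ?gt_eqF//.
  rewrite sqr_sqrtr; last by rewrite divr_ge0// mulr_ge0// ?ltW// exprn_gt0.
  rewrite exprVn [leLHS](_ : _ = C)//.
  by field; rewrite gt_eqF// exprn_gt0.
- by move=> t tx; rewrite -EF; apply: Fle0.
Qed.

(** The term s = 0 is 1 and the others are nonnegative at 1. This serves theta = pi/2, where no t0 >
    0 lies below cos theta. *)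
Lemma M_LP_ge1 m (theta : R) (P : nat -> {poly R}) :
  jacobi_polys m.+3 P -> (1 <= M_LP P theta)%E.
Proof.
move=> /jacobi_polys_gegen[P0 Pc].
apply: le_ereal_inf_tmp => _ /= [F [n [a [EF a_ge0 a0 _]]] <-].
rewrite lee_fin EF horner_sum big_ord_recl /= a0 P0 scale1r hornerC lerDl.
apply: sumr_ge0 => i _; rewrite hornerZ; apply: mulr_ge0.
  exact/a_ge0/ltn_ord.
have [c c0 ->] := Pc (bump 0 i).
by rewrite hornerZ mulr_ge0 ?ltW// gegen_at1_gt0.
Qed.
End JacobiGegenbauer.

(** * Binomial asymptotics and the exponential rate *)

Definition rate_entropy {R : realType} (r : R) : R :=
  (1 + r) * ln (1 + r) - r * ln r.

(** [rate_entropy r] is the growth rate of C((1+r)N, rN); the average with ln(1 + 2r) reflects the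
    square root in [M_LP_ge]. *)
Definition rate {R : realType} (r : R) : R :=
  (rate_entropy r + ln (1 + 2 * r)) / 2.

Section Asymptotics.
Context {R : realType}.

(** Induction with n ln((n+1)/n) <= 1. Together with [ln_fact_le] this replaces Stirling's formula,
    at the cost of a logarithm. *)
Lemma ln_fact_ge n : n%:R * ln n%:R - n%:R <= ln (n`!)%:R :> R.
Proof.
elim: n => [|n IHn]; first by rewrite fact0 ln1 mul0r subrr.
have [->|n0] := posnP n; first by rewrite ln1 mulr0 sub0r oppr_le0.
have n0' : 0 < n%:R :> R by rewrite ltr0n.
have np : 0 < n.+1%:R :> R by [].
rewrite factS natrM lnM ?posrE ?ltr0n ?fact_gt0//.
have : ln (n.+1%:R / n%:R) <= n%:R^-1 :> R.
  have -> : n.+1%:R / n%:R = 1 + n%:R^-1 :> R by rewrite -natr1; field; rewrite gt_eqF.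
  by apply: le_ln1Dx; apply: lt_trans (_ : 0 < _); rewrite ?invr_gt0// ltrN10.
rewrite ln_div ?posrE// => /(ler_wpM2l (ltW n0')); rewrite divff ?gt_eqF//.
rewrite -natr1 in np *; lra.
Qed.

Lemma ln_fact_le n : (0 < n)%N ->
  ln (n`!)%:R <= n%:R * ln n%:R - n%:R + ln n%:R + 1 :> R.
Proof.
elim: n => [//|n IHn] _; have [->|n0] := posnP n.
  by rewrite factS fact0 ln1 mulr0 sub0r addr0 addNr.
have n0' : 0 < n%:R :> R by rewrite ltr0n.
have np : 0 < n.+1%:R :> R by [].
rewrite factS natrM lnM ?posrE ?ltr0n ?fact_gt0//.
have : ln (n%:R / n.+1%:R) <= - n.+1%:R^-1 :> R.
  have E : n%:R / n.+1%:R = 1 + - n.+1%:R^-1 :> R.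
    by rewrite -natr1 in np *; field; rewrite gt_eqF.
  rewrite E; apply: le_ln1Dx.
  by rewrite -subr_gt0 opprK addrC -E divr_gt0.
rewrite ln_div ?posrE// => /(ler_wpM2l (ltW np)); rewrite mulrN divff ?gt_eqF//.
by have := IHn n0; rewrite -natr1 in np *; lra.
Qed.

(** In the factorial bounds the linear terms cancel, and the n ln n terms combine into the
    entropy. *)
Lemma ln_bin_ge (N k : nat) : (0 < N)%N -> (0 < k)%N ->
  N%:R * rate_entropy (k%:R / N%:R) - ln N%:R - ln k%:R - 2
    <= ln 'C(N + k, k)%:R :> R.
Proof.
move=> N0 k0.
have N0' : 0 < N%:R :> R by rewrite ltr0n.
have k0' : 0 < k%:R :> R by rewrite ltr0n.
have f0 m : 0 < (m`!)%:R :> R by rewrite ltr0n fact_gt0.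
have E : ln 'C(N + k, k)%:R = ln ((N + k)`!)%:R - ln (k`!)%:R - ln (N`!)%:R :> R.
  rewrite -(bin_fact (leq_addl N k)) addnK !natrM.
  have C0 : 0 < 'C(N + k, k)%:R :> R by rewrite ltr0n bin_gt0 leq_addl.
  by rewrite !lnM ?posrE ?mulr_gt0//; ring.
have -> : N%:R * rate_entropy (k%:R / N%:R) =
  (N + k)%:R * ln (N + k)%:R - N%:R * ln N%:R - k%:R * ln k%:R :> R.
  rewrite /rate_entropy.
  have -> : 1 + k%:R / N%:R = (N + k)%:R / N%:R :> R.
    by rewrite natrD; field; rewrite gt_eqF.
  have NK0 : 0 < (N + k)%:R :> R by rewrite natrD addr_gt0.
  rewrite !ln_div ?posrE//.
  by move: (ln _) (ln _) (ln _) => a b c; rewrite natrD; field; rewrite gt_eqF.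
rewrite E; have := ln_fact_ge (N + k); have := ln_fact_le N0; have := ln_fact_le k0.
rewrite natrD; lra.
Qed.

Lemma rate_entropy_continuous (r : R) : 0 < r -> {for r, continuous rate_entropy}.
Proof.
move=> r0; have r1 : 0 < 1 + r by rewrite addr_gt0.
have c1 : {for r, continuous (fun u : R => 1 + u)}.
  by apply: cvgD; [exact: cvg_cst|exact: cvg_id].
apply: cvgB; apply: cvgM.
- exact: c1.
- by apply: continuous_cvg; [exact: continuous_ln|exact: c1].
- exact: cvg_id.
- exact: continuous_ln.
Qed.

Lemma rate_continuous (r : R) : 0 < r -> {for r, continuous rate}.
Proof.
move=> r0; apply: cvgM; last exact: cvg_cst.
apply: cvgD; first exact: rate_entropy_continuous.
apply: continuous_cvg; first by apply: continuous_ln; rewrite addr_gt0// mulr_gt0.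
by apply: cvgD; [exact: cvg_cst|apply: cvgM; [exact: cvg_cst|exact: cvg_id]].
Qed.

Lemma cvg_truncn_div (r : R) : 0 <= r ->
  (Num.truncn (r * n%:R))%:R / n%:R @[n --> \oo] --> r.
Proof.
move=> r0; apply/cvgrPdist_le => e e0; near=> n.
have n0 : 0 < n%:R :> R by rewrite ltr0n; near: n; exact: nbhs_infty_gt.
have rn : 0 <= r * n%:R by rewrite mulr_ge0// ltW.
have /andP[t1 t2] := truncn_itv rn; rewrite -natr1 in t2.
have E : r - (Num.truncn (r * n%:R))%:R / n%:R =
  (r * n%:R - (Num.truncn (r * n%:R))%:R) / n%:R.
  by field; rewrite gt_eqF.
rewrite E ger0_norm; last by rewrite divr_ge0// subr_ge0.
rewrite ler_pdivrMr//.
have : e^-1 * 1 <= n%:R by near: n; exact: nbhs_infty_ger.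
by rewrite ler_pdivrMl//; lra.
Unshelve. all: by end_near. Qed.

(** With s = sqrt(n+1), ln(n+1) <= 2s, and multiples of s are absorbed by e s^2 once s >= 8/e. *)
Lemma ln_nat_negligible (a e : R) : 0 < e ->
  \forall n \near \oo, a + 2 * ln n.+1%:R <= e * n.+3%:R.
Proof.
move=> e0; near=> n.
pose s : R := Num.sqrt n.+1%:R.
have s0 : 0 < s by rewrite sqrtr_gt0.
have s2 : s ^+ 2 = n.+1%:R by rewrite sqr_sqrtr.
have lns : ln n.+1%:R <= 2 * s.
  by rewrite -s2 lnXn// mulr2n; have := ln_sublinear s0; lra.
have n1 : 2 * a / e <= n%:R by near: n; exact: nbhs_infty_ger.
have n2 : (8 / e) ^+ 2 <= n%:R by near: n; exact: nbhs_infty_ger.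
have s8 : 8 / e <= s.
  rewrite -[leLHS]ger0_norm ?divr_ge0 ?(ltW e0)// -sqrtr_sqr ler_wsqrtr//.
  by rewrite (le_trans n2)// ler_nat.
have h1 : 2 * a <= e * n%:R by rewrite -ler_pdivrMl// mulrC.
have h2 : 8 <= e * s by rewrite -ler_pdivrMl// mulrC.
have h3 := ler_wpM2r (ltW s0) h2.
have h4 : e * s * s = e * n.+1%:R by rewrite -s2; ring.
have h5 : n.+3%:R = n%:R + 3 :> R by rewrite -natrD addn3.
have h6 : n.+1%:R = n%:R + 1 :> R by rewrite natr1.
rewrite h4 h6 in h3; rewrite h5; lra.
Unshelve. all: by end_near. Qed.

(** Take k = floor(rho N) with N = n - 3. Half of [e] pays for replacing rho by k/N, the other half
    for constants and logarithms. *)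
Lemma M_LP_rate (theta rho e : R) (P : nat -> nat -> {poly R}) :
  (forall n, (2 <= n)%N -> jacobi_polys n (P n)) ->
  0 < rho -> Num.sqrt (1 - (1 + 2 * rho) ^- 2) < cos theta -> 0 < e ->
  \forall N \near \oo,
    (((N.+3%:R * (rate rho - e))%:E) <= lne (M_LP (P N.+3) theta))%E.
Proof.
move=> hP rho0 t0x e0.
set x := cos theta in t0x; set t0 := Num.sqrt _ in t0x.
pose A := (1 - x) / (x - t0).
have A0 : 0 <= A by rewrite /A divr_ge0// subr_ge0 ?cos_le1// ltW.
have A1 : 0 < 1 + A by rewrite ltr_wpDr.
pose X (N : nat) : R :=
  (rate_entropy ((Num.truncn (rho * N%:R))%:R / N%:R) + ln (1 + 2 * rho)) / 2.
have cvgX : X N @[N --> \oo] --> rate rho.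
  apply: cvgM; last exact: cvg_cst.
  apply: cvgD; last exact: cvg_cst.
  apply: (cvg_comp _ _ (cvg_truncn_div (ltW rho0))).
  exact: rate_entropy_continuous.
pose c : R := ln rho / 2 + 1 + ln 2 / 2 + ln (1 + A).
near=> N.
have X1 : rate rho - e / 2 <= X N.
  near: N; apply: (cvgr_ge _ cvgX); lra.
have X2 : X N <= rate rho + 1.
  near: N; apply: (cvgr_le _ cvgX); lra.
have N1 : (1 < N)%N by near: N; exact: nbhs_infty_gt.
(* The term 3 (rate rho + 1) pays for N + 3 against N; 2 ln(N+1) covers the logarithms from the
   binomial and from the factor N + 1 in [M_LP_ge]. *)
have small : 3 * (rate rho + 1) + c + 2 * ln N.+1%:R <= e / 2 * N.+3%:R.
  by near: N; apply: ln_nat_negligible; lra.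
have N0 : 0 < N%:R :> R by rewrite ltr0n ltnW.
have rN : 1 <= rho * N%:R.
  rewrite -ler_pdivrMl// mulr1; near: N; exact: nbhs_infty_ger.
pose k := Num.truncn (rho * N%:R).
have rN0 : 0 <= rho * N%:R by lra.
have /andP[kr _] := truncn_itv rN0.
have k0 : (0 < k)%N by rewrite truncn_gt0.
have k0' : 0 < k%:R :> R by rewrite ltr0n.
have [m Nm] : exists m, N = m.+2 by case: (N) N1 => [|[|m]] // _; exists m.
have bound := @M_LP_ge R m k theta rho (P N.+3).
rewrite -Nm in bound.
have {}bound := bound (hP N.+3 isT) rho0 t0x kr.
rewrite -/x -/t0 -/A in bound.
have C0 : 0 < 'C(N + k, k)%:R :> R by rewrite ltr0n bin_gt0 leq_addl.
set b := _ / _ in bound.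
have d0 : 0 < 1 + 2 * rho by rewrite addr_gt0// mulr_gt0.
have q0 : 0 < 'C(N + k, k)%:R * (1 + 2 * rho) ^+ N / 2.
  by rewrite divr_gt0// mulr_gt0// exprn_gt0.
have b0 : 0 < b by rewrite divr_gt0 ?sqrtr_gt0// mulr_gt0.
apply: (@le_trans _ _ (lne b%:E)); last first.
  rewrite lee_lne ?in_itv/= ?leey ?andbT//; first by rewrite lee_fin ltW.
  by apply: le_trans bound; rewrite lee_fin ltW.
rewrite lne_EFin// lee_fin /b.
rewrite ln_div ?posrE ?sqrtr_gt0//; last by rewrite mulr_gt0.
rewrite -(powR12_sqrt (ltW q0)) ln_powR.
rewrite ln_div ?posrE ?mulr_gt0 ?exprn_gt0// !lnM ?posrE ?exprn_gt0// lnXn//.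
rewrite -[_ *+ N]mulr_natl.
have lnk : ln k%:R <= ln rho + ln N%:R :> R.
  by rewrite -lnM ?posrE// ler_ln ?posrE ?mulr_gt0.
have lnN : ln N%:R <= ln N.+1%:R :> R by rewrite ler_ln ?posrE// ler_nat.
have := ln_bin_ge (ltnW N1) k0.
have XE : N%:R * rate_entropy (k%:R / N%:R) =
  N%:R * (2 * X N) - N%:R * ln (1 + 2 * rho) :> R by rewrite /X; field.
rewrite XE.
have h3 : N.+3%:R = N%:R + 3 :> R by rewrite -natrD addn3.
have h4 : N.+3%:R * (rate rho - e / 2) <= N.+3%:R * X N by rewrite ler_wpM2l.
rewrite h3 in small h4 *.
rewrite /c in small; lra.
Unshelve. all: by end_near. Qed.
End Asymptotics.

(** * The rate at the limiting cap, and the passage to the limit *)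

Section Exponent.
Context {R : realType}.

(** This argument of [rate] solves 1 + 2 rho = 1 / sin theta, the limiting case where sqrt(1 - t0^2)
    is sin theta. *)
Lemma LP_exponentE (theta : R) : 0 < sin theta ->
  LP_exponent theta = rate ((1 - sin theta) / (2 * sin theta)).
Proof.
move=> s0; rewrite /LP_exponent /rate /rate_entropy; set s := sin theta in s0 *.
have -> : 1 + (1 - s) / (2 * s) = (1 + s) / (2 * s) by field; rewrite gt_eqF.
have -> : 1 + 2 * ((1 - s) / (2 * s)) = 1 / s by field; rewrite gt_eqF.
by rewrite /=; ring.
Qed.

Lemma M_LP_exponent (theta e : R) (P : nat -> nat -> {poly R}) :
  (forall n, (2 <= n)%N -> jacobi_polys n (P n)) ->
  0 < theta <= pi / 2 -> 0 < e ->
  \forall N \near \oo,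
    ((N.+3%:R * (LP_exponent theta - e))%:E <= lne (M_LP (P N.+3) theta))%E.
Proof.
move=> hP /andP[th0 th2] e0.
move: th2; rewrite le_eqVlt => /predU1P[->|th2].
  (* At theta = pi/2 the exponent is 0, so the trivial bound by 1 suffices. *)
  apply: nearW => N; apply: (@le_trans _ _ 0%:E).
    rewrite lee_fin LP_exponentE sin_pihalf// subrr mul0r /rate /rate_entropy.
    rewrite addr0 mulr0 addr0 ln1 !mul0r mulr0 subr0 addr0 mul0r sub0r.
    by rewrite mulrN oppr_le0 mulr_ge0// ltW.
  by rewrite lne_ge0; apply: M_LP_ge1; apply: hP.
have s0 : 0 < sin theta by apply: sin_gt0_pihalf; rewrite th0.
have c0 : 0 < cos theta.
  apply: cos_gt0_pihalf; rewrite th2 andbT (lt_trans _ th0)//.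
  by rewrite oppr_lt0 divr_gt0// pi_gt0.
have s1 : sin theta < 1.
  rewrite -(ltr_pXn2r (n := 2))// ?nnegrE ?ltW// expr1n sin2cos2 ltrBlDr ltrDl.
  by rewrite exprn_gt0.
rewrite LP_exponentE//; set s := sin theta in s0 s1 *.
set v := (1 - s) / (2 * s).
have v0 : 0 < v by rewrite divr_gt0 ?subr_gt0// mulr_gt0.
(* At rho = v the points t0 and cos theta coincide and A would degenerate; left continuity of [rate]
   allows rho < v at the cost of e/2. *)
have [rho [rho0 rhov rate_rho]] : exists rho,
    [/\ 0 < rho, rho < v & rate v - e / 2 <= rate rho].
  have cr : rate r @[r --> v^'-] --> rate v.
    by apply: cvg_at_left_filter; exact: rate_continuous.
  have : \forall r \near v^'-, [/\ 0 < r, r < v & rate v - e / 2 <= rate r].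
    near=> r; split.
    - by near: r; exact: nbhs_left_gt.
    - by near: r; exact: nbhs_left_lt.
    - by near: r; apply: (cvgr_ge _ cr); lra.
  by case/filter_ex => r; exists r.
have d0 : 0 < 1 + 2 * rho by lra.
have ds : (1 + 2 * rho) * s < 1.
  have : rho * (2 * s) < 1 - s by rewrite -ltr_pdivlMr// mulr_gt0.
  lra.
have t0x : Num.sqrt (1 - (1 + 2 * rho) ^- 2) < cos theta.
  rewrite -[ltRHS]ger0_norm ?(ltW c0)// -sqrtr_sqr ltr_sqrt ?exprn_gt0//.
  rewrite cos2sin2 ltrD2l ltrN2 -/s -exprVn ltr_pXn2r ?nnegrE ?invr_ge0 ?ltW//.
  by rewrite -[ltRHS]mulr1 ltr_pdivlMl.
have e2 : 0 < e / 2 by lra.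
apply: filterS (M_LP_rate hP rho0 t0x e2) => N; apply: le_trans.
by rewrite lee_fin ler_wpM2l//; lra.
Unshelve. all: by end_near. Qed.

End Exponent.

Theorem corollary1p3 (R : realType) (P : nat -> nat -> {poly R})
    (hP : forall n : nat, (2 <= n)%N -> jacobi_polys n (P n))
    (theta : R) (htheta : 0 < theta <= pi / 2) :
  exists o : nat -> R,
    o n @[n --> \oo] --> (0 : R) /\
    \forall n \near \oo,
      ((LP_exponent theta + o n)%:E <=
         (n%:R^-1)%:E * lne (M_LP (P n) theta))%E.
Proof.
pose L := LP_exponent theta.
pose e n : \bar R := ((n%:R^-1)%:E * lne (M_LP (P n) theta))%E.
have Le d : 0 < d -> \forall n \near \oo, ((L - d)%:E <= e n)%E.
  move=> d0; have [N0 _ HN] := M_LP_exponent hP htheta d0.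
  exists N0.+3 => // n /= N0n.
  have [N nN] : exists N, n = N.+3 by exists (n - 3)%N; lia.
  have NN0 : (N0 <= N)%N by lia.
  rewrite /e nN; have /= h := HN N NN0.
  have n0 : (0 <= (N.+3%:R^-1 : R)%:E)%E by rewrite lee_fin invr_ge0.
  have := lee_wpmul2l n0 h.
  by rewrite -EFinM mulKf.
(* [e n] is an extended real with no upper bound established here; truncating at [L] makes it
   eventually finite and squeezes it into [L - d, L], so the error tends to 0. *)
pose m n : \bar R := mine (e n) L%:E.
have m_fin d n : ((L - d)%:E <= e n)%E -> 0 < d ->
    exists2 r, m n = r%:E & L - d <= r <= L.
  move=> Lde d0.
  have : ((L - d)%:E <= m n)%E by rewrite le_min Lde lee_fin gerBl ltW.
  have : (m n <= L%:E)%E by rewrite ge_min lexx orbT.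
  case: (m n) => [r| |] //; rewrite !lee_fin => h1 h2.
  by exists r => //; rewrite h1 h2.
exists (fun n => fine (m n) - L); split.
  apply/cvgrPdist_le => d d0; apply: filterS (Le d d0) => n Lde.
  have [r -> /andP[r1 r2]] := m_fin d n Lde d0.
  by rewrite /= sub0r opprB ger0_norm; lra.
apply: filterS (Le 1 ltr01) => n Lde.
have [r Er _] := m_fin 1 n Lde ltr01.
by rewrite -/L addrC subrK Er /= -Er /m ge_min lexx.
Qed.
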